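(* $\mathsf{EMB}_{<\omega}\equiv_{\mathrm{sW}}\mathsf{GAC}_{<\omega}\equiv_{\mathrm{sW}}\mathsf{C}^{\subset}_{\max}\equiv_{\mathrm{sW}}\mathsf{C}^{\#}_{\max}$.
   Context: A Weihrauch problem is a relation between instances and solutions (coded as elements of $\mathbb{N}^\mathbb{N}$ or $\mathbb{N}$). $P\le_{\mathrm{sW}}Q$ if there are computable functionals $\Phi,\Psi$ such that for every instance $S$ of $P$, $\Phi(S)$ is an instance of $Q$ and for every solution $R$ of $\Phi(S)$, $\Psi(R)$ is a solution of $S$; $\equiv_{\mathrm{sW}}$ is the induced equivalence. $[\mathbb{N}]^{<\mathbb{N}}$ is the set of finite subsets of $\mathbb{N}$, and $[\mathbb{N}]^{<\mathbb{N}}_{\ne\emptyset}$ the nonempty ones. An e-matroid is $(M,e)$ with $M\subseteq\mathbb{N}$, $e\colon\mathbb{N}\to$ finite subsets of $M$, such that $e(k)\ne\emptyset$ for all $k$, every finite $Y\subseteq M$ containing some $e(k)$ is in the range of $e$, and for finite $X,Y\subseteq M$ with $|X|<|Y|$ not in the range of $e$, some $y\in Y$ has $X\cup\{y\}$ not in the range of $e$. Its rank is at most $n$ if every subset of $M$ of size $n$ is in the range of $e$. A basis is $B\subseteq M$ with $e(k)\not\subseteq B$ for all $k$ such that for each $x\in M\setminus B$ some $e(k)\subseteq B\cup\{x\}$. $\mathsf{EMB}_{<\omega}$: instances are pairs $(n,M)$ with $n\in\mathbb{N}$ and $M$ an e-matroid of rank at most $n$; solutions are bases of $M$. $\mathsf{GAC}_{<\omega}$: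 instances are pairs $(n,G)$ with $G$ a countable graph in which every set of $n$ vertices contains a pair connected by a path; solutions are maximal antichains of $G$ (maximal sets of vertices no two connected by a path). $\mathsf{C}^{\subset}_{\max}$: instances are pairs $(n,f)$ with $f\colon\mathbb{N}\to[\mathbb{N}]^{<\mathbb{N}}_{\ne\emptyset}$ whose range contains every finite set of cardinality $\ge n$; solutions are $X\in[\mathbb{N}]^{<\mathbb{N}}$ with $X\notin\operatorname{range}(f)$ and every finite $Y\supsetneq X$ in $\operatorname{range}(f)$. $\mathsf{C}^{\#}_{\max}$: same instances; solutions are $X\in[\mathbb{N}]^{<\mathbb{N}}$ with $X\notin\operatorname{range}(f)$ and every finite $Y$ with $|Y|>|X|$ in $\operatorname{range}(f)$. *)

(* Defs.v *)
From mathcomp Require Import all_boot finmap.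

Set Implicit Arguments.
Unset Strict Implicit.
Unset Printing Implicit Defensive.

Local Open Scope fset_scope.
Local Open Scope nat_scope.

(** * Computable functionals on Baire space *)

(* Partial recursive functions relative to an oracle (Kleene): the least class
   containing zero, successor, projections and the oracle, closed under
   composition, primitive recursion and minimization.  Programs carry no
   arity; superfluous arguments are ignored and missing ones make the
   computation undefined. *)
Inductive prog : Type :=
  | PZero
  | PSucc
  | PProj of nat
  | POracle
  | PComp of prog & seq prog
  | PRec of prog & prog
  | PMin of prog.

(* [eval p c xs y] : with oracle [p], the program [c] halts on [xs] with
   value [y]. *)
Inductive eval (p : nat -> nat) : prog -> seq nat -> nat -> Prop :=
  | EvalZero xs : eval p PZero xs 0
  | EvalSucc x xs : eval p PSucc (x :: xs) x.+1
  | EvalProj i xs : i < size xs -> eval p (PProj i) xs (nth 0 xs i)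
  | EvalOracle x xs : eval p POracle (x :: xs) (p x)
  | EvalComp f gs xs ys y :
      size ys = size gs ->
      (forall i, i < size gs -> eval p (nth PZero gs i) xs (nth 0 ys i)) ->
      eval p f ys y ->
      eval p (PComp f gs) xs y
  | EvalRec0 f g xs y :
      eval p f xs y ->
      eval p (PRec f g) (0 :: xs) y
  | EvalRecS f g n xs y z :
      eval p (PRec f g) (n :: xs) y ->
      eval p g (n :: y :: xs) z ->
      eval p (PRec f g) (n.+1 :: xs) z
  | EvalMin f xs n (h : nat -> nat) :
      eval p f (n :: xs) 0 ->
      (forall m, m < n -> eval p f (m :: xs) (h m).+1) ->
      eval p (PMin f) xs n.

(* The functional computed by [c] is defined at [p], with value [q]. *)
Definition computes (c : prog) (p q : nat -> nat) : Prop :=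
  forall n, eval p c [:: n] (q n).

(** * Coding and Weihrauch problems *)

(* [names p x] : the point [p] of Baire space codes [x]. *)
Record repr_space : Type := ReprSpace {
  carrier :> Type;
  names : (nat -> nat) -> carrier -> Prop
}.

(* Objects coded by a natural number [code x] become points of Baire space
   through the usual representation of N, which reads off the first value. *)
Definition coded_space (T : Type) (code : T -> nat) : repr_space :=
  @ReprSpace T (fun p x => p 0 = code x).

Definition fun_space (T : Type) (code : T -> nat) : repr_space :=
  @ReprSpace (nat -> T) (fun p f => forall i, p i = code (f i)).

Definition prod_space (A B : repr_space) : repr_space :=
  @ReprSpace (A * B) (fun p z =>
    names (fun i => p i.*2) z.1 /\ names (fun i => p i.*2.+1) z.2).

Definition nat_space : repr_space := coded_space (@id nat).

(* Subsets of N, coded by characteristic functions. *)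
Definition set_space : repr_space := fun_space nat_of_bool.

(* Cantor's pairing function. *)
Definition pair_code (x y : nat) : nat := 'C((x + y).+1, 2) + y.

Definition rel_space : repr_space :=
  @ReprSpace (rel nat) (fun p E => forall x y, p (pair_code x y) = E x y).

(* Canonical index of a finite set. *)
Definition fset_code (A : {fset nat}) : nat := \sum_(i <- A) 2 ^ i.

Definition fset_space : repr_space := coded_space fset_code.

Definition fset_fun_space : repr_space := fun_space fset_code.

Record problem : Type := Problem {
  inst_space : repr_space;
  sol_space : repr_space;
  instance : inst_space -> Prop;
  solution : inst_space -> sol_space -> Prop
}.

Definition sW_le (P Q : problem) : Prop :=
  exists phi psi : prog,
  forall (p : nat -> nat) (S : inst_space P), names p S -> instance S ->
  exists (q : nat -> nat) (S' : inst_space Q),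
    [/\ computes phi p q, names q S', instance S' &
      forall (r : nat -> nat) (R' : sol_space Q), names r R' ->
      solution S' R' ->
      exists (s : nat -> nat) (R : sol_space P),
        [/\ computes psi r s, names s R & solution S R]].

Definition sW_equiv (P Q : problem) : Prop := sW_le P Q /\ sW_le Q P.

Definition in_range (f : nat -> {fset nat}) (Y : {fset nat}) : Prop :=
  exists k, f k = Y.

(** * Enumerated matroids *)

(* The exchange clause does not ask for [y \notin X]; an element [y] common to
   [X] and [Y] satisfies it trivially. *)
Definition ematroid (M : pred nat) (e : nat -> {fset nat}) : Prop :=
  [/\ forall k, {subset e k <= M},
      forall k, e k != fset0,
      forall Y : {fset nat}, {subset Y <= M} ->
        (exists k, e k `<=` Y) -> in_range e Y
    & forall X Y : {fset nat}, {subset X <= M} -> {subset Y <= M} ->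
        #|` X| < #|` Y| -> ~ in_range e X -> ~ in_range e Y ->
        exists2 y, y \in Y & ~ in_range e (y |` X)].

Definition rank_at_most (n : nat) (M : pred nat) (e : nat -> {fset nat}) :
    Prop :=
  forall Y : {fset nat}, {subset Y <= M} -> #|` Y| = n -> in_range e Y.

Definition basis (M : pred nat) (e : nat -> {fset nat}) (B : pred nat) :
    Prop :=
  [/\ {subset B <= M},
      forall k, ~ {subset e k <= B}
    & forall x, x \in M -> x \notin B ->
        exists k, {subset e k <= [predU1 x & B]}].

(* A basis of an e-matroid of rank at most [n] has fewer than [n] elements;
   solutions are coded by natural numbers, as finite sets. *)
Definition EMB_fin : problem := {|
  inst_space := prod_space nat_space (prod_space set_space fset_fun_space);
  sol_space := fset_space;
  instance := fun '((n, (M, e)) : nat * (pred nat * (nat -> {fset nat}))) =>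
    ematroid M e /\ rank_at_most n M e;
  solution := fun '((n, (M, e)) : nat * (pred nat * (nat -> {fset nat})))
                  (B : {fset nat}) => basis M e (mem B)
|}.

(** * Countable graphs *)

Definition graph (V : pred nat) (E : rel nat) : Prop :=
  [/\ forall x y, E x y -> x \in V /\ y \in V, symmetric E & irreflexive E].

Definition path_connected (E : rel nat) (x y : nat) : Prop :=
  exists2 s, path E x s & last x s = y.

Definition antichain (V : pred nat) (E : rel nat) (A : pred nat) : Prop :=
  {subset A <= V} /\
  forall x y, x \in A -> y \in A -> x != y -> ~ path_connected E x y.

Definition maximal_antichain (V : pred nat) (E : rel nat) (A : pred nat) :
    Prop :=
  antichain V E A /\
  forall A' : pred nat, antichain V E A' -> {subset A <= A'} -> A' =i A.

(* As for bases, the antichains in question have fewer than [n] elements. *)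
Definition GAC_fin : problem := {|
  inst_space := prod_space nat_space (prod_space set_space rel_space);
  sol_space := fset_space;
  instance := fun '((n, (V, E)) : nat * (pred nat * rel nat)) =>
    graph V E /\
    forall Y : {fset nat}, {subset Y <= V} -> #|` Y| = n ->
      exists x y, [/\ x \in Y, y \in Y, x != y & path_connected E x y];
  solution := fun '((n, (V, E)) : nat * (pred nat * rel nat))
                  (A : {fset nat}) => maximal_antichain V E (mem A)
|}.

(** * Choice of maximal finite sets *)

Definition cmax_instance (z : nat * (nat -> {fset nat})) : Prop :=
  let: (n, f) := z in
  (forall k, f k != fset0) /\
  forall Y : {fset nat}, n <= #|` Y| -> in_range f Y.

Definition Cmax_subset : problem := {|
  inst_space := prod_space nat_space fset_fun_space;
  sol_space := fset_space;
  instance := cmax_instance;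
  solution := fun '((n, f) : nat * (nat -> {fset nat})) (X : {fset nat}) =>
    ~ in_range f X /\ forall Y : {fset nat}, X `<` Y -> in_range f Y
|}.

Definition Cmax_card : problem := {|
  inst_space := prod_space nat_space fset_fun_space;
  sol_space := fset_space;
  instance := cmax_instance;
  solution := fun '((n, f) : nat * (nat -> {fset nat})) (X : {fset nat}) =>
    ~ in_range f X /\
    forall Y : {fset nat}, #|` X| < #|` Y| -> in_range f Y
|}.

(* Main.v *)
Require Import Defs.
From mathcomp Require Import all_boot finmap zify.
From Stdlib Require Import Classical.

Set Implicit Arguments.
Unset Strict Implicit.
Unset Printing Implicit Defensive.

Local Open Scope fset_scope.
Local Open Scope nat_scope.

(** All problems are linked in a cycle GAC <= EMB <= Cmax_subset <= Cmax_card <=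
    GAC by primitive recursive functionals.

    GAC <= EMB: a set of vertices is dependent when two of its members are
    connected; bases are the maximal antichains.  EMB <= Cmax_subset: enumerate
    the finite sets that are dependent or leave the ground set.  A set of maximal
    size outside the range is a fortiori maximal for inclusion.

    Cmax_card <= GAC: let [m] be the maximal size of a set outside the range of
    [f].  For a level [i > 0], the least code [a] of a missing set of size at
    least [i] exists iff [i <= m].  A vertex [(i, a, t)] asserts that by stage
    [t] all smaller candidates have been enumerated; once [a] itself is
    enumerated the vertex gets linked to a common bottom component.  What
    remains is the bottom component and one component for each level [1..m], so
    a maximal antichain has [m + 1] elements.  Its cardinality thus reveals [m],
    and among its vertices of level [m] the largest witness is the right one:
    a larger witness would assert that the right one has been enumerated. *)

(** * Primitive recursive functionals *)

(* [xs] is an environment of [k] variables, read through [head] and [behead];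
   the program must not depend on the oracle [p]. *)
Definition computable (k : nat) (F : (nat -> nat) -> seq nat -> nat) : Prop :=
  exists c, forall p xs, size xs = k -> eval p c xs (F p xs).

Lemma eq_computable k F G :
  (forall p xs, F p xs = G p xs) -> computable k F -> computable k G.
Proof. by move=> FG [c cF]; exists c => p xs Hxs; rewrite -FG; apply: cF. Qed.

Lemma head_iter_behead i xs : head 0 (iter i behead xs) = nth 0 xs i.
Proof. by elim: i xs => [|i IH] [|x xs] //; rewrite iterSr IH //= nth_nil. Qed.

Lemma computable_arg i k : i < k ->
  computable k (fun _ xs => head 0 (iter i behead xs)).
Proof.
move=> ik; exists (PProj i) => p xs Hxs; rewrite head_iter_behead.
by apply: EvalProj; rewrite Hxs.
Qed.

Lemma computable_comp k (H : (nat -> nat) -> seq nat -> nat)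
    (Fs : seq ((nat -> nat) -> seq nat -> nat)) :
  computable (size Fs) H ->
  (forall i, i < size Fs -> computable k (nth (fun _ _ => 0) Fs i)) ->
  computable k (fun p xs => H p [seq F p xs | F <- Fs]).
Proof.
move=> [c Hc] HF.
have [gs [Sgs Hgs]] : exists gs : seq prog, size gs = size Fs /\
  forall i, i < size Fs -> forall p xs, size xs = k ->
    eval p (nth PZero gs i) xs (nth (fun _ _ => 0) Fs i p xs).
  elim: Fs {H c Hc} HF => [|F Fs IH] HF; first by exists [::].
  have [|gs [Sgs Hgs]] := IH; first by move=> i Hi; apply: (HF i.+1).
  have [c Hc] := HF 0 isT.
  by exists (c :: gs); split=> [|[|i] Hi] /=; rewrite ?Sgs //; apply: Hgs.
exists (PComp c gs) => p xs Hxs.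
apply: (@EvalComp _ _ _ _ [seq F p xs | F <- Fs]); first by rewrite size_map.
  move=> i; rewrite Sgs => Hi; rewrite (nth_map (fun _ _ => 0)) //.
  exact: Hgs.
by apply: Hc; rewrite size_map.
Qed.

Lemma computable_const k n : computable k (fun _ _ => n).
Proof.
elim: n => [|n [c Hc]]; first by exists PZero => p xs _; apply: EvalZero.
exists (PComp PSucc [:: c]) => p xs Hxs.
apply: (@EvalComp _ _ _ _ [:: n]) => //; last exact: EvalSucc.
by case=> [|i] // _; apply: Hc.
Qed.

Lemma computable_fun1 (H : (nat -> nat) -> nat -> nat) k F :
  computable 1 (fun p xs => H p (head 0 xs)) -> computable k F ->
  computable k (fun p xs => H p (F p xs)).
Proof.
by move=> cH cF; apply: (computable_comp (Fs := [:: F]) cH) => -[|i].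
Qed.

Lemma computable_fun2 (H : (nat -> nat) -> nat -> nat -> nat) k F G :
  computable 2 (fun p xs => H p (head 0 xs) (head 0 (behead xs))) ->
  computable k F -> computable k G ->
  computable k (fun p xs => H p (F p xs) (G p xs)).
Proof.
by move=> cH cF cG; apply: (computable_comp (Fs := [:: F; G]) cH) => -[|[|i]].
Qed.

Lemma computable_oracle k F :
  computable k F -> computable k (fun p xs => p (F p xs)).
Proof.
move=> cF; apply: (computable_fun1 (H := fun p x => p x)) => //.
by exists POracle => p [|x []] // _; apply: EvalOracle.
Qed.

Lemma computable_succ k F :
  computable k F -> computable k (fun p xs => (F p xs).+1).
Proof.
apply: (computable_fun1 (H := fun _ x => x.+1)).
by exists PSucc => p [|x []] // _; apply: EvalSucc.
Qed.

Lemma computable_rec k B F0 (G : nat -> nat -> (nat -> nat) -> seq nat -> nat) :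
  computable k B -> computable k F0 ->
  computable k.+2
    (fun p xs => G (head 0 xs) (head 0 (behead xs)) p (behead (behead xs))) ->
  computable k (fun p xs =>
    nat_rect (fun _ => nat) (F0 p xs) (fun n y => G n y p xs) (B p xs)).
Proof.
move=> cB [c0 H0] [cG HG].
pose R p xs := nat_rect (fun _ => nat) (F0 p (behead xs))
  (fun n y => G n y p (behead xs)) (head 0 xs).
have cR : computable k.+1 R.
  exists (PRec c0 cG) => p [|n xs] //= [Hxs]; rewrite /R /=.
  elim: n => [|n IH] /=; first by apply: EvalRec0; apply: H0.
  apply: EvalRecS IH _.
  by apply: (HG p [:: n, _ & xs]); rewrite /= Hxs.
(* [PRec] wants its counter as first argument; feeding [R] with [B] followed by all [k] projections
   leaves the environment intact behind it. *)
pose A i : (nat -> nat) -> seq nat -> nat := fun _ xs => head 0 (iter i behead xs).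
pose Fs := B :: [seq A i | i <- iota 0 k].
have SF : size Fs = k.+1 by rewrite /= size_map size_iota.
have := @computable_comp k R Fs; rewrite SF => /(_ cR) H.
have {}H : computable k (fun p xs => R p [seq F p xs | F <- Fs]).
  apply: H => -[|i] //= Hi; rewrite (nth_map 0) ?size_iota // nth_iota //.
  exact: computable_arg.
case: H => c Hc; exists c => p xs Hxs.
have := Hc p xs Hxs; rewrite /R /= -map_comp.
suff -> : [seq ((fun F => F p xs) \o A) i | i <- iota 0 k] = xs by [].
apply: (@eq_from_nth _ 0) => [|i]; first by rewrite size_map size_iota.
rewrite size_map size_iota => Hi.
by rewrite (nth_map 0) ?size_iota // nth_iota //= /A head_iter_behead.
Qed.

Ltac computable_arg_tac :=
  first [ exact: (@computable_arg 0) | exact: (@computable_arg 1)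
        | exact: (@computable_arg 2) | exact: (@computable_arg 3)
        | exact: (@computable_arg 4) | exact: (@computable_arg 5) ].

(** * Arithmetic, bounded search and decidable predicates *)

Lemma computable_pred k F :
  computable k F -> computable k (fun p xs => (F p xs).-1).
Proof.
apply: (computable_fun1 (H := fun _ x => x.-1)).
have H : computable 1 (fun _ xs => head 0 xs) by computable_arg_tac.
apply: eq_computable (computable_rec (G := fun n _ _ _ => n) H
  (computable_const 1 0) _); last by computable_arg_tac.
by move=> p xs; case: (head 0 xs).
Qed.

Lemma computable_add k F G : computable k F -> computable k G ->
  computable k (fun p xs => F p xs + G p xs).
Proof.
apply: (computable_fun2 (H := fun _ x y => x + y)).
apply: (eq_computable _ (computable_rec (F0 := fun _ xs => head 0 xs)
  (B := fun _ xs => head 0 (behead xs)) (G := fun _ y _ _ => y.+1) _ _ _)).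
- by move=> p xs; elim: (head 0 (behead xs)) => [|n /= ->]; rewrite ?addn0 ?addnS.
- by computable_arg_tac.
- by computable_arg_tac.
- by apply: computable_succ; computable_arg_tac.
Qed.

Lemma computable_sub k F G : computable k F -> computable k G ->
  computable k (fun p xs => F p xs - G p xs).
Proof.
apply: (computable_fun2 (H := fun _ x y => x - y)).
apply: (eq_computable _ (computable_rec (F0 := fun _ xs => head 0 xs)
  (B := fun _ xs => head 0 (behead xs)) (G := fun _ y _ _ => y.-1) _ _ _)).
- by move=> p xs; elim: (head 0 (behead xs)) => [|n /= ->]; rewrite ?subn0 ?subnS.
- by computable_arg_tac.
- by computable_arg_tac.
- by apply: computable_pred; computable_arg_tac.
Qed.

(** The step of a recursion sees the counter, the accumulator and the environment; this drops the
    accumulator, which the summand of a bounded sum or maximum must not see. *)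
Lemma computable_skip k (F : nat -> (nat -> nat) -> seq nat -> nat) :
  computable k.+1 (fun p xs => F (head 0 xs) p (behead xs)) ->
  computable k.+2 (fun p xs => F (head 0 xs) p (behead (behead xs))).
Proof.
move=> cF.
pose A i : (nat -> nat) -> seq nat -> nat := fun _ xs => head 0 (iter i behead xs).
pose Fs := A 0 :: [seq A i.+2 | i <- iota 0 k].
have SF : size Fs = k.+1 by rewrite /= size_map size_iota.
have := @computable_comp k.+2 (fun p xs => F (head 0 xs) p (behead xs)) Fs.
rewrite SF => /(_ cF) [].
  case=> [|i] Hi; first exact: computable_arg.
  by rewrite /= (nth_map 0) ?size_iota // nth_iota //; apply: computable_arg.
move=> d Hd; exists d => p [|x [|y xs]] // [Hxs].
have := Hd p [:: x, y & xs]; rewrite /= Hxs => /(_ erefl).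
suff -> : [seq F p [:: x, y & xs] | F <- [seq A i.+2 | i <- iota 0 k]] = xs by [].
rewrite -map_comp; apply: (@eq_from_nth _ 0) => [|i].
  by rewrite size_map size_iota.
rewrite size_map size_iota => Hi.
by rewrite (nth_map 0) ?size_iota // nth_iota // /comp /A head_iter_behead.
Qed.

Lemma computable_sum k B (F : nat -> (nat -> nat) -> seq nat -> nat) :
  computable k B ->
  computable k.+1 (fun p xs => F (head 0 xs) p (behead xs)) ->
  computable k (fun p xs => \sum_(0 <= i < B p xs) F i p xs).
Proof.
move=> cB cF.
apply: (eq_computable _ (computable_rec (F0 := fun _ _ => 0) (B := B)
  (G := fun n y p xs => y + F n p xs) cB _ _)).
- move=> p xs; elim: (B p xs) => [|n /= ->]; first by rewrite big_geq.
  by rewrite big_nat_recr.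
- exact: computable_const.
- by apply: computable_add; [computable_arg_tac | apply: computable_skip].
Qed.

Lemma computable_max k B (F : nat -> (nat -> nat) -> seq nat -> nat) :
  computable k B ->
  computable k.+1 (fun p xs => F (head 0 xs) p (behead xs)) ->
  computable k (fun p xs => \max_(0 <= i < B p xs) F i p xs).
Proof.
move=> cB cF.
apply: (eq_computable _ (computable_rec (F0 := fun _ _ => 0) (B := B)
  (G := fun n y p xs => F n p xs + (y - F n p xs)) cB _ _)).
- move=> p xs; elim: (B p xs) => [|n /= ->]; first by rewrite big_geq.
  by rewrite big_nat_recr //= -maxnE maxnC.
- exact: computable_const.
- have cF' := computable_skip cF.
  by apply: computable_add cF' (computable_sub _ cF'); computable_arg_tac.
Qed.

Lemma computable_mul k F G : computable k F -> computable k G ->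
  computable k (fun p xs => F p xs * G p xs).
Proof.
apply: (computable_fun2 (H := fun _ x y => x * y)).
apply: (eq_computable _ (computable_sum (B := fun _ xs => head 0 xs)
  (F := fun _ _ xs => head 0 (behead xs)) _ _)).
- by move=> p xs; rewrite sum_nat_const_nat subn0.
- by computable_arg_tac.
- by computable_arg_tac.
Qed.

Lemma computable_exp k F G : computable k F -> computable k G ->
  computable k (fun p xs => F p xs ^ G p xs).
Proof.
apply: (computable_fun2 (H := fun _ x y => x ^ y)).
apply: (eq_computable _ (computable_rec (F0 := fun _ _ => 1)
  (B := fun _ xs => head 0 (behead xs))
  (G := fun _ y _ xs => head 0 xs * y) _ _ _)).
- by move=> p xs; elim: (head 0 (behead xs)) => [|n /= ->] //; rewrite expnS.
- by computable_arg_tac.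
- exact: computable_const.
- by apply: computable_mul; computable_arg_tac.
Qed.

Lemma computable_leq k F G : computable k F -> computable k G ->
  computable k (fun p xs => nat_of_bool (F p xs <= G p xs)).
Proof.
move=> cF cG; apply: eq_computable (computable_sub (computable_const k 1)
  (computable_sub cF cG)) => p xs.
by rewrite -subn_eq0; case: (F p xs - G p xs) => [|[]].
Qed.

Lemma computable_and k (P Q : (nat -> nat) -> seq nat -> bool) :
  computable k P -> computable k Q ->
  computable k (fun p xs => nat_of_bool (P p xs && Q p xs)).
Proof.
move=> cP cQ; apply: eq_computable (computable_mul cP cQ) => p xs.
by rewrite mulnb.
Qed.

Lemma computable_not k (P : (nat -> nat) -> seq nat -> bool) :
  computable k P -> computable k (fun p xs => nat_of_bool (~~ P p xs)).
Proof.
move=> cP; apply: eq_computable (computable_sub (computable_const k 1) cP) => p xs.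
by case: (P p xs).
Qed.

Lemma computable_or k (P Q : (nat -> nat) -> seq nat -> bool) :
  computable k P -> computable k Q ->
  computable k (fun p xs => nat_of_bool (P p xs || Q p xs)).
Proof.
move=> cP cQ.
apply: eq_computable (computable_not (computable_and (computable_not cP)
  (computable_not cQ))) => p xs.
by rewrite negb_and !negbK.
Qed.

Lemma computable_eq k F G : computable k F -> computable k G ->
  computable k (fun p xs => nat_of_bool (F p xs == G p xs)).
Proof.
move=> cF cG; apply: eq_computable (computable_and (computable_leq cF cG)
  (computable_leq cG cF)) => p xs.
by rewrite eqn_leq.
Qed.

Lemma computable_if k (P : (nat -> nat) -> seq nat -> bool) F G :
  computable k P -> computable k F -> computable k G ->
  computable k (fun p xs => if P p xs then F p xs else G p xs).
Proof.
move=> cP cF cG; apply: eq_computable (computable_add (computable_mul cP cF)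
  (computable_mul (computable_not cP) cG)) => p xs.
by case: (P p xs); rewrite ?mul0n ?mul1n ?addn0.
Qed.

Lemma computable_has k B (P : nat -> (nat -> nat) -> seq nat -> bool) :
  computable k B ->
  computable k.+1 (fun p xs => P (head 0 xs) p (behead xs)) ->
  computable k (fun p xs =>
    nat_of_bool (has (fun i => P i p xs) (iota 0 (B p xs)))).
Proof.
move=> cB cP; have := computable_sum (F := fun i p xs => P i p xs) cB cP.
move=> /(computable_leq (computable_const k 1)).
apply: eq_computable => p xs; congr nat_of_bool.
rewrite has_count -sum1_count -[X in iota 0 X]subn0.
by rewrite -/(index_iota 0 _) [in RHS]big_mkcond; congr (0 < _).
Qed.

Lemma computable_all k B (P : nat -> (nat -> nat) -> seq nat -> bool) :
  computable k B ->
  computable k.+1 (fun p xs => P (head 0 xs) p (behead xs)) ->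
  computable k (fun p xs =>
    nat_of_bool (all (fun i => P i p xs) (iota 0 (B p xs)))).
Proof.
move=> cB cP.
apply: eq_computable (computable_not (computable_has
  (P := fun i p xs => ~~ P i p xs) cB (computable_not cP))) => p xs.
by rewrite -all_predC; congr nat_of_bool; apply: eq_all => i /=; rewrite negbK.
Qed.

Lemma computable_div k F G : computable k F -> computable k G ->
  computable k (fun p xs => F p xs %/ G p xs).
Proof.
apply: (computable_fun2 (H := fun _ x y => x %/ y)).
pose x (p : nat -> nat) xs := head 0 xs; pose d (p : nat -> nat) xs := head 0 (behead xs).
have cx : computable 2 x by computable_arg_tac.
have cd : computable 2 d by computable_arg_tac.
(* The quotient is the largest [i] with [i * d <= x]. The guard [0 < d] makes the maximum 0 for a
   zero divisor, in agreement with [divn]. *)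
apply: (eq_computable _ (computable_max (B := fun p xs => (x p xs).+1)
  (F := fun i p xs => ((0 < d p xs) && (i * d p xs <= x p xs)) * i)
  (computable_succ cx) _)); last first.
  apply: computable_mul; last by computable_arg_tac.
  apply: computable_and; first by apply: computable_leq;
    [apply: computable_const|computable_arg_tac].
  apply: computable_leq; last by computable_arg_tac.
  by apply: computable_mul; computable_arg_tac.
move=> p xs; have [d0|dp] := posnP (d p xs).
  by rewrite -/(x p xs) -/(d p xs) d0 divn0 big1.
rewrite -/(x p xs) -/(d p xs) big_mkord; apply/eqP; rewrite eqn_leq.
apply/andP; split.
  apply/bigmax_leqP => i _.
  have [Hi|Hi] := leqP (i * d p xs) (x p xs); last by [].
  by rewrite /= mul1n leq_divRL.
have Hi : x p xs %/ d p xs < (x p xs).+1 by rewrite ltnS leq_div.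
by apply: leq_trans (leq_bigmax (Ordinal Hi)); rewrite /= leq_divM mul1n.
Qed.

(* Tried first, since unification would otherwise unfold the named functions
   and apply the lemma for their bodies. *)
Ltac computability_extra := fail.

(* [nat_of_bool] unfolds to a conditional, on which [computable_if] would loop. *)
Ltac computability_step := lazymatch goal with
  | |- computable _ (fun _ _ => nat_of_bool _) => first
    [ assumption
    | computability_extra
    | apply: computable_const
    | apply: computable_leq
    | apply: computable_eq
    | apply: computable_and
    | apply: computable_or
    | apply: computable_not
    | apply: computable_has
    | apply: computable_all ]
  | |- computable _ _ => first
    [ assumption
    | computability_extra
    | apply: computable_const
    | computable_arg_tac
    | apply: computable_oracle
    | apply: computable_succ
    | apply: computable_pred
    | apply: computable_add
    | apply: computable_sub
    | apply: computable_mul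
    | apply: computable_exp
    | apply: computable_div
    | apply: computable_max
    | apply: computable_sum
    | apply: computable_if ]
  end.

Ltac computability := repeat computability_step.

Lemma computable_mod k F G : computable k F -> computable k G ->
  computable k (fun p xs => F p xs %% G p xs).
Proof.
move=> cF cG.
apply: (eq_computable (F := fun p xs => F p xs - F p xs %/ G p xs * G p xs)).
  by move=> p xs; rewrite {1}(divn_eq (F p xs) (G p xs)) addKn.
by computability.
Qed.

Lemma computable_odd k F :
  computable k F -> computable k (fun p xs => nat_of_bool (odd (F p xs))).
Proof.
move=> cF; apply: eq_computable (computable_mod cF (computable_const k 2)) => p xs.
by rewrite modn2.
Qed.

Lemma computable_half k F :
  computable k F -> computable k (fun p xs => (F p xs)./2).
Proof.
move=> cF; apply: eq_computable (computable_div cF (computable_const k 2)) => p xs.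
by rewrite divn2.
Qed.

Lemma computable_double k F :
  computable k F -> computable k (fun p xs => (F p xs).*2).
Proof.
move=> cF; apply: eq_computable (computable_add cF cF) => p xs.
by rewrite addnn.
Qed.

Ltac computability_extra ::= first
  [ apply: computable_mod | apply: computable_odd | apply: computable_half
  | apply: computable_double ].

(** * Pairing and codes of finite sets *)

Lemma bin2_pair s : 'C(s.+1, 2) = \sum_(0 <= i < s.+1) i.
Proof. by rewrite -bin2_sum. Qed.

Lemma computable_pair_code k F G : computable k F -> computable k G ->
  computable k (fun p xs => pair_code (F p xs) (G p xs)).
Proof.
move=> cF cG; apply: (eq_computable (F := fun p xs =>
  \sum_(0 <= i < (F p xs + G p xs).+1) i + G p xs)).
  by move=> p xs; rewrite /pair_code bin2_pair.
by computability.
Qed.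

Ltac computability_extra ::= first
  [ apply: computable_mod | apply: computable_odd | apply: computable_half
  | apply: computable_double | apply: computable_pair_code ].

Lemma pair_code_inj x y x' y' :
  pair_code x y = pair_code x' y' -> x = x' /\ y = y'.
Proof.
(* Codes increase strictly from one diagonal to the next, so the code determines the sum and then
   the second component. *)
have lt_pair u v u' v' : u + v < u' + v' -> pair_code u v < pair_code u' v'.
  move=> H; rewrite /pair_code.
  apply: (@leq_trans 'C((u + v).+2, 2)).
    by rewrite [X in _ < X]binS bin1; lia.
  by apply: leq_trans (leq_addr _ _); apply: leq_bin2l.
have [lt|lt|E] := ltngtP (x + y) (x' + y').
- by have := lt_pair _ _ _ _ lt; lia.
- by have := lt_pair _ _ _ _ lt; lia.
by rewrite /pair_code E => /addnI Ey; move: E; rewrite Ey => /addIn.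
Qed.

Lemma leq_pair_code x y : x <= pair_code x y /\ y <= pair_code x y.
Proof.
have : x + y <= 'C((x + y).+1, 2) by rewrite binS bin1; lia.
by rewrite /pair_code; lia.
Qed.

(** Decoding by exhaustive search: both components are bounded by the code, and by injectivity
    exactly one summand survives at the code of a pair. *)
Definition unpair_with (h : nat -> nat -> nat) (z : nat) : nat :=
  \sum_(0 <= x < z.+1) \sum_(0 <= y < z.+1) (pair_code x y == z) * h x y.

Lemma unpair_withK h x y : unpair_with h (pair_code x y) = h x y.
Proof.
have [Hx Hy] := leq_pair_code x y; rewrite /unpair_with.
rewrite (bigD1_seq x) ?mem_index_iota ?iota_uniq //=.
rewrite (bigD1_seq y) ?mem_index_iota ?iota_uniq //= eqxx mul1n.
rewrite big1 ?addn0 => [|y' Hy']; last first.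
  case E: (_ == _) => //; move/eqP: E Hy' => /pair_code_inj[_ ->].
  by rewrite eqxx.
rewrite big1 ?addn0 // => x' Hx'; rewrite big1 // => y' _.
case E: (_ == _) => //; move/eqP: E Hx' => /pair_code_inj[-> _].
by rewrite eqxx.
Qed.

Definition unpair1 := unpair_with (fun x _ => x).
Definition unpair2 := unpair_with (fun _ y => y).

Lemma pair_code1K x y : unpair1 (pair_code x y) = x.
Proof. exact: unpair_withK. Qed.

Lemma pair_code2K x y : unpair2 (pair_code x y) = y.
Proof. exact: unpair_withK. Qed.

Lemma computable_unpair1 k F :
  computable k F -> computable k (fun p xs => unpair1 (F p xs)).
Proof.
apply: (computable_fun1 (H := fun _ => unpair1)).
by rewrite /unpair1 /unpair_with; computability.
Qed.

Lemma computable_unpair2 k F :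
  computable k F -> computable k (fun p xs => unpair2 (F p xs)).
Proof.
apply: (computable_fun1 (H := fun _ => unpair2)).
by rewrite /unpair2 /unpair_with; computability.
Qed.

(** * Binary digits and canonical indices *)

Definition bit (a i : nat) : bool := odd (a %/ 2 ^ i).

Lemma computable_bit k F G : computable k F -> computable k G ->
  computable k (fun p xs => nat_of_bool (bit (F p xs) (G p xs))).
Proof. by move=> cF cG; rewrite /bit; computability. Qed.

Ltac computability_extra ::= first
  [ apply: computable_mod | apply: computable_odd | apply: computable_half
  | apply: computable_double | apply: computable_pair_code | apply: computable_unpair1
  | apply: computable_unpair2 | apply: computable_bit ].

Lemma sum_bits_recl N (b : pred nat) :
  \sum_(0 <= i < N.+1) b i * 2 ^ i =
  b 0 + (\sum_(0 <= i < N) b i.+1 * 2 ^ i).*2.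
Proof.
rewrite big_nat_recl // expn0 muln1 -muln2 big_distrl /=.
by congr (_ + _); apply: eq_bigr => i _; rewrite expnSr mulnA.
Qed.

Lemma bit_sum N (b : pred nat) j :
  bit (\sum_(0 <= i < N) b i * 2 ^ i) j = (j < N) && b j.
Proof.
elim: N b j => [|N IH] b j; first by rewrite big_geq // /bit div0n.
rewrite sum_bits_recl; case: j => [|j].
  by rewrite /bit divn1 oddD odd_double addbF oddb.
by rewrite /bit expnS divnMA divn2 half_bit_double; apply: IH.
Qed.

Lemma sum_bit N a : a < 2 ^ N -> \sum_(0 <= i < N) bit a i * 2 ^ i = a.
Proof.
elim: N a => [|N IH] a; first by rewrite big_geq // expn0; case: a.
move=> Ha; rewrite sum_bits_recl.
under eq_bigr => i _ do rewrite /bit expnS divnMA divn2.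
have := IH a./2; rewrite /bit => ->; first by rewrite divn1 odd_double_half.
by move: Ha; rewrite expnS; lia.
Qed.

Lemma bit_lt a i : bit a i -> i < a.
Proof.
rewrite /bit; case: (ltnP i a) => // Hi.
by rewrite divn_small //; apply: leq_ltn_trans Hi (ltn_expl _ _).
Qed.

Lemma fset_code_sum (A : {fset nat}) N : {in A, forall i, i < N} ->
  fset_code A = \sum_(0 <= i < N) (i \in A) * 2 ^ i.
Proof.
move=> HA; rewrite /fset_code.
under [RHS]eq_bigr do rewrite mulnbl -[0]/(0 * 2 ^ 0).
rewrite (perm_big [seq i <- index_iota 0 N | i \in A]).
  rewrite big_filter big_mkcond; apply: eq_bigr => i _ /=.
  by case: (i \in A).
apply: uniq_perm; rewrite ?fset_uniq ?filter_uniq ?iota_uniq // => i.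
rewrite mem_filter mem_index_iota /=; case Ai: (i \in A) => //=.
by rewrite HA.
Qed.

Lemma fset_bounded (A : {fset nat}) : {in A, forall i, i < (\max_(i <- A) i).+1}.
Proof. by move=> i Ai; rewrite ltnS (big_rem i) //= leq_maxl. Qed.

Lemma bit_fset_code (A : {fset nat}) i : bit (fset_code A) i = (i \in A).
Proof.
rewrite (fset_code_sum (@fset_bounded A)) bit_sum.
by case Ai: (i \in A); rewrite ?andbF // fset_bounded.
Qed.

Lemma fset_code_inj : injective fset_code.
Proof. by move=> A B E; apply/fsetP => i; rewrite -!bit_fset_code E. Qed.

Lemma ltn_fset_code (A : {fset nat}) i : i \in A -> i < fset_code A.
Proof. by rewrite -bit_fset_code => /bit_lt. Qed.

(** The explicit bound turns the code of the set into a bounded sum, hence into something computable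
    when [b] is. *)
Definition bounded_fset (N : nat) (b : pred nat) : {fset nat} :=
  [fset i in iota 0 N | b i].

Lemma in_bounded_fset N b i : (i \in bounded_fset N b) = (i < N) && b i.
Proof. by rewrite !inE mem_iota. Qed.

Lemma fset_code_bounded_fset N b :
  fset_code (bounded_fset N b) = \sum_(0 <= i < N) b i * 2 ^ i.
Proof.
rewrite (@fset_code_sum _ N) => [|i]; last by rewrite in_bounded_fset => /andP[].
rewrite big_nat_cond [RHS]big_nat_cond; apply: eq_bigr => i.
by rewrite andbT in_bounded_fset /= => ->.
Qed.

Definition fset_decode (a : nat) : {fset nat} := bounded_fset a (bit a).

Lemma fset_decodeK a : fset_code (fset_decode a) = a.
Proof. by rewrite fset_code_bounded_fset sum_bit // ltn_expl. Qed.

Lemma in_fset_decode a i : (i \in fset_decode a) = bit a i.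
Proof. by rewrite -bit_fset_code fset_decodeK. Qed.

Lemma fset_codeK : cancel fset_code fset_decode.
Proof. by move=> A; apply: fset_code_inj; rewrite fset_decodeK. Qed.

Lemma fset_code_eq0 (A : {fset nat}) : (fset_code A == 0) = (A == fset0).
Proof.
rewrite -(inj_eq fset_code_inj); congr (_ == _).
by rewrite /fset_code big_seq_fset0.
Qed.

Definition card_code (a : nat) : nat := \sum_(0 <= i < a) bit a i.

Lemma card_codeE a : card_code a = #|` fset_decode a|.
Proof.
have /perm_size -> :
  perm_eq (fset_decode a) [seq i <- index_iota 0 a | bit a i].
  apply: uniq_perm; rewrite ?fset_uniq ?filter_uniq ?iota_uniq // => i.
  rewrite in_fset_decode mem_filter mem_index_iota /=.
  by case bi: (bit a i); rewrite // bit_lt.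
rewrite size_filter -sum1_count [RHS]big_mkcond.
by apply: eq_bigr => i _; case: bit.
Qed.

Lemma computable_card_code k F :
  computable k F -> computable k (fun p xs => card_code (F p xs)).
Proof.
apply: (computable_fun1 (H := fun _ => card_code)).
by rewrite /card_code; computability.
Qed.

Ltac computability_extra ::= first
  [ apply: computable_mod | apply: computable_odd | apply: computable_half
  | apply: computable_double | apply: computable_pair_code | apply: computable_unpair1
  | apply: computable_unpair2 | apply: computable_bit
  | apply: computable_card_code ].

(** The pigeonhole principle for an injection given only as a relation in [Prop], such as being
    joined by a path, so that no function has to be chosen. *)
Lemma leq_card_fset_rel (T U : choiceType) (R : T -> U -> Prop)
    (Y : {fset T}) (X : {fset U}) :
  {in Y, forall y, exists2 x, x \in X & R y x} ->
  {in Y &, forall y y', forall x, R y x -> R y' x -> y = y'} ->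
  #|` Y| <= #|` X|.
Proof.
have sub (s : seq T) : uniq s -> {in s, forall y, exists2 x, x \in X & R y x} ->
    {in s &, forall y y', forall x, R y x -> R y' x -> y = y'} ->
  size s <= #|` X|; last exact: (sub Y (fset_uniq Y)).
elim: s X => [|y s IH] X //= /andP[ys us] HX inj.
have [x Xx Ryx] := HX y (mem_head _ _).
rewrite (cardfsD1 x) Xx ltnS; apply: IH => // [y' sy'|y1 y2 s1 s2].
  have [|x' Xx' Ryx'] := HX y'; first by rewrite inE sy' orbT.
  exists x' => //; rewrite !inE Xx' andbT; apply: contraNneq ys => xx'.
  rewrite xx' in Ryx'.
  by rewrite (inj y y' _ _ x) // inE ?eqxx ?sy' ?orbT.
by apply: inj; rewrite inE ?s1 ?s2 orbT.
Qed.

(** * Strong Weihrauch reductions *)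

(** The layout of a name in a product nested to the right: [u] at even positions, [a] at positions 1
    modulo 4 and [b] at positions 3 modulo 4. *)
Definition triple_name (u : nat) (a b : nat -> nat) (j : nat) : nat :=
  if odd j then if odd j./2 then b j./2./2 else a j./2./2 else u.

Lemma computable_triple_name k u (a b : (nat -> nat) -> seq nat -> nat -> nat) F :
  computable k u ->
  computable k (fun p xs => a p xs (F p xs)./2./2) ->
  computable k (fun p xs => b p xs (F p xs)./2./2) ->
  computable k F ->
  computable k (fun p xs => triple_name (u p xs) (a p xs) (b p xs) (F p xs)).
Proof. by move=> cu ca cb cF; rewrite /triple_name; computability. Qed.

Lemma triple_name1 u a b i : triple_name u a b i.*2.*2.+1 = a i.
Proof. by rewrite /triple_name /= odd_double /= uphalf_double odd_double doubleK. Qed.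

Lemma triple_name2 u a b i : triple_name u a b i.*2.+1.*2.+1 = b i.
Proof.
by rewrite /triple_name /= odd_double /= uphalf_double /= odd_double uphalf_double.
Qed.

Lemma sW_le_computable (P Q : problem) phi psi :
  computable 1 (fun p xs => phi p (head 0 xs)) ->
  computable 1 (fun r xs => psi r (head 0 xs)) ->
  (forall p (S : inst_space P), names p S -> instance S ->
    exists S' : inst_space Q, [/\ names (phi p) S', instance S' &
      forall r (R' : sol_space Q), names r R' -> solution S' R' ->
      exists R : sol_space P, names (psi r) R /\ solution S R]) ->
  sW_le P Q.
Proof.
move=> [c Hc] [d Hd] H; exists c, d => p S pS iS.
have [S' [nS' iS' HS']] := H p S pS iS; exists (phi p), S'; split=> //.
  by move=> n; apply: (Hc p [:: n]).
move=> r R' rR' sR'; have [R [nR sR]] := HS' r R' rR' sR'.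
by exists (psi r), R; split=> // n; apply: (Hd r [:: n]).
Qed.

(** * Composition of functionals and transitivity of reducibility *)

Fixpoint oracle_subst (c d : prog) : prog :=
  match d with
  | POracle => PComp c [:: PProj 0]
  | PComp f gs => PComp (oracle_subst c f) [seq oracle_subst c g | g <- gs]
  | PRec f g => PRec (oracle_subst c f) (oracle_subst c g)
  | PMin f => PMin (oracle_subst c f)
  | _ => d
  end.

Lemma eval_oracle_subst c p q d xs y :
  computes c p q -> eval q d xs y -> eval p (oracle_subst c d) xs y.
Proof.
move=> cpq; elim=> /= {d xs y}.
- by move=> xs; apply: EvalZero.
- by move=> x xs; apply: EvalSucc.
- by move=> i xs; apply: EvalProj.
- move=> x xs; apply: (@EvalComp _ _ _ _ [:: x]) => //.
  by case=> [_|//]; apply: (@EvalProj p 0 (x :: xs)).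
- move=> f gs xs ys y Sys _ IHgs _ IHf.
  apply: (@EvalComp _ _ _ _ ys) => //; rewrite ?size_map // => i Hi.
  by rewrite (nth_map PZero) //; apply: IHgs.
- by move=> f g xs y _; apply: EvalRec0.
- by move=> f g n xs y z _ IH1 _; apply: EvalRecS.
- by move=> f xs n h _ IH0 _ IHm; apply: (@EvalMin _ _ _ _ h).
Qed.

Lemma computes_comp c d p q r :
  computes c p q -> computes d q r -> computes (oracle_subst c d) p r.
Proof. by move=> cpq dqr n; apply: eval_oracle_subst cpq (dqr n). Qed.

Lemma sW_le_trans P Q R : sW_le P Q -> sW_le Q R -> sW_le P R.
Proof.
move=> [phi1 [psi1 H1]] [phi2 [psi2 H2]].
exists (oracle_subst phi1 phi2), (oracle_subst psi2 psi1) => p S pS iS.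
have [q [S' [c1 qS' iS' K1]]] := H1 p S pS iS.
have [q' [S'' [c2 qS'' iS'' K2]]] := H2 q S' qS' iS'.
exists q', S''; split=> //; first exact: computes_comp c1 c2.
move=> r A rA sA; have [s [B [d2 sB solB]]] := K2 r A rA sA.
have [t [C [d1 tC solC]]] := K1 s B sB solB.
by exists t, C; split=> //; apply: computes_comp d2 d1.
Qed.

Lemma Cmax_subset_le_Cmax_card : sW_le Cmax_subset Cmax_card.
Proof.
apply: (sW_le_computable (phi := id) (psi := id)).
- by computability.
- by computability.
move=> p [n f] pS iS; exists (n, f); split=> // r X rX [HX HY].
by exists X; split=> //; split=> // Y XY; apply: HY; apply: fproper_ltn_card.
Qed.

(** * Bases as maximal independent sets *)

(* The characteristic function [M] and the codes of [e] sit at the positions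
   [v.*2.*2.+1] and [j.*2.+1.*2.+1] of a name of [(n, (M, e))]. *)
Definition dependent_code (p : nat -> nat) (k : nat) : nat :=
  let a := unpair1 k in
  let v := unpair1 (unpair2 k) in
  let ej := p (unpair2 (unpair2 k)).*2.+1.*2.+1 in
  \sum_(0 <= x < a + v.+1 + ej)
    (bit a x || ((p v.*2.*2.+1 == 1) && bit ej x)
             || ((p v.*2.*2.+1 != 1) && (x == v))) * 2 ^ x.

(** An index packs a finite set with a point and an index of [e]. The point either certifies by
    itself that the set leaves [M], or hands over to [e]; adding the certificate to an arbitrary set
    closes the range upwards. *)
Definition dependent_fset (M : pred nat) (e : nat -> {fset nat}) (k : nat) :=
  let D := fset_decode (unpair1 k) in
  let v := unpair1 (unpair2 k) in
  if v \in M then D `|` e (unpair2 (unpair2 k)) else v |` D.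

Lemma dependent_codeE (p : nat -> nat) (M : pred nat) (e : nat -> {fset nat})
    k :
  (forall v, p v.*2.*2.+1 = M v) ->
  (forall j, p j.*2.+1.*2.+1 = fset_code (e j)) ->
  dependent_code p k = fset_code (dependent_fset M e k).
Proof.
move=> pM pe.
rewrite /dependent_code -fset_code_bounded_fset; congr fset_code.
apply/fsetP => x; rewrite in_bounded_fset pM pe bit_fset_code /dependent_fset.
rewrite -[unpair1 (unpair2 k) \in M]/(M _).
set v := unpair1 (unpair2 k); set j := unpair2 _; set a := unpair1 k.
case: (M v); rewrite /= ?in_fsetU ?in_fset1 !in_fset_decode ?orbF.
  apply: andb_idl => /orP[/bit_lt|/ltn_fset_code]; lia.
by rewrite orbC; apply: andb_idl => /orP[/eqP|/bit_lt]; lia.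
Qed.

Lemma in_range_dependent (M : pred nat) (e : nat -> {fset nat})
    (Y : {fset nat}) : (forall k, {subset e k <= M}) ->
  (forall k, e k != fset0) ->
  in_range (dependent_fset M e) Y <->
  (exists2 v, v \in Y & v \notin M) \/ (exists j, e j `<=` Y).
Proof.
move=> eM e0; split=> [[k <-]|].
  rewrite /dependent_fset; case: ifPn => Mv.
    by right; exists (unpair2 (unpair2 k)); apply: fsubsetUr.
  by left; exists (unpair1 (unpair2 k)); rewrite ?inE ?eqxx.
case=> [[v Yv Mv]|[j ejY]].
  exists (pair_code (fset_code Y) (pair_code v 0)).
  rewrite /dependent_fset !(pair_code1K, pair_code2K) (negbTE Mv).
  by rewrite fset_codeK; apply/fsetUidPr; rewrite fsub1set.
(* Any point of [M] selects the branch that adds [e j]; an element of [e j] is such a point. *)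
have /fset0Pn[v ev] := e0 j.
exists (pair_code (fset_code Y) (pair_code v j)).
rewrite /dependent_fset !(pair_code1K, pair_code2K).
by rewrite (eM j _ ev) fset_codeK; apply/fsetUidPl.
Qed.

Lemma fsubset_card_exists (T : choiceType) (Y : {fset T}) n :
  n <= #|` Y| -> exists2 Z, Z `<=` Y & #|` Z| = n.
Proof.
move=> nY; exists [fset x in take n Y].
  by apply/fsubsetP => x; rewrite !inE => /mem_take.
have /perm_size -> : perm_eq [fset x in take n Y] (take n Y).
  by apply: uniq_perm => [||x]; rewrite ?fset_uniq ?take_uniq ?fset_uniq ?inE.
by rewrite size_takel.
Qed.

Lemma EMB_fin_le_Cmax_subset : sW_le EMB_fin Cmax_subset.
Proof.
apply: (sW_le_computable (psi := id)
  (phi := fun p j => if odd j then dependent_code p j./2 else p 0)).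
- by rewrite /dependent_code; computability.
- by computability.
move=> p [n [M e]] [/= pn [pM pe]] [[eM e0 eU eX] rk].
have range := in_range_dependent _ eM e0.
exists (n, dependent_fset M e); split.
- split=> //= i; rewrite odd_double /= uphalf_double.
  exact: dependent_codeE.
- split=> [k|Y nY].
    by apply/eqP => H; have : in_range (dependent_fset M e) fset0;
      [exists k | case/range => [[v]|[j]]; rewrite ?inE // fsubset0 (negbTE (e0 j))].
  apply/range; case: (classic (exists2 v, v \in Y & v \notin M)) => [|YM]; first by left.
  (* The rank bound speaks of size exactly [n], so it is applied to a subset of [Y]. *)
  right; have [Z ZY Zn] := fsubset_card_exists nY.
  have [||j ejZ] := rk Z; rewrite ?Zn //; last by exists j; rewrite ejZ.
  move=> v Zv.
  by apply/negPn/negP => Mv; apply: YM; exists v => //; apply: (fsubsetP ZY).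
move=> r B rB [Brange Bmax]; exists B; split=> //.
have BM : {subset B <= M}.
  by move=> v Bv; apply/negPn/negP => Mv; apply: Brange; apply/range; left; exists v.
split=> // [k ekB|x Mx Bx].
  by apply: Brange; apply/range; right; exists k; apply/fsubsetP.
(* By maximality the enlarged set is enumerated. It stays inside [M], so the reason must be some
   [e j] contained in it. *)
have /Bmax/range[[v]|[j]] : B `<` x |` B by rewrite fproperEcard fsubsetUr cardfsU1
    (Bx : x \notin B) ltnSn.
  by rewrite !inE => /orP[/eqP->|/BM->] //; rewrite Mx.
by move=> /fsubsetP ej; exists j => v /ej; rewrite !inE.
Qed.

(** * The matroid of a graph *)

Definition digit (b c j : nat) : nat := c %/ b ^ j %% b.

Lemma digits_exist b (s : seq nat) : {in s, forall x, x < b} ->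
  exists c, forall j, j < size s -> digit b c j = nth 0 s j.
Proof.
elim: s => [|x s IH] Hs; first by exists 0.
have [|c Hc] := IH; first by move=> y sy; apply: Hs; rewrite inE sy orbT.
have xb : x < b by apply: Hs; rewrite inE eqxx.
have b0 : 0 < b by apply: leq_trans xb.
exists (c * b + x) => -[|j] Hj; rewrite /digit.
  by rewrite divn1 modnMDl modn_small.
by rewrite expnS divnMA divnMDl // (divn_small xb) addn0; apply: Hc.
Qed.

Lemma path_connected_refl E x : path_connected E x x.
Proof. by exists [::]. Qed.

Lemma path_connected_trans E x y z :
  path_connected E x y -> path_connected E y z -> path_connected E x z.
Proof.
move=> [s Es <-] [t Et <-]; exists (s ++ t); rewrite ?cat_path ?Es //.
by rewrite last_cat.
Qed.

Lemma path_connected1 (E : rel nat) x y : E x y -> path_connected E x y.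
Proof. by exists [:: y]; rewrite //= andbT. Qed.

Lemma path_connected_sym (E : rel nat) x y :
  symmetric E -> path_connected E x y -> path_connected E y x.
Proof.
move=> symE [s Es <-]; elim: s x Es => [|z s IH] x /=.
  by move=> _; apply: path_connected_refl.
move=> /andP[Exz /IH Es]; apply: path_connected_trans Es _.
by apply: path_connected1; rewrite symE.
Qed.

Lemma path_connected_iter (E : rel nat) (g : nat -> nat) l :
  (forall j, j < l -> E (g j) (g j.+1)) -> path_connected E (g 0) (g l).
Proof.
elim: l => [|l IH] H; first exact: path_connected_refl.
apply: path_connected_trans (path_connected1 (H l (ltnSn l))).
by apply: IH => j jl; apply: H; apply: ltnW.
Qed.

(** Paths become triples of numbers, with a base above every vertex visited, so that an enumeration
    can run through all candidate paths. *)
Lemma path_connected_digits (E : rel nat) x y : path_connected E x y ->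
  exists b c l, [/\ digit b c 0 = x, digit b c l = y &
    forall j, j < l -> E (digit b c j) (digit b c j.+1)].
Proof.
move=> [s Es <-]; exists (\max_(z <- x :: s) z).+1.
have [|c Hc] := @digits_exist (\max_(z <- x :: s) z).+1 (x :: s).
  by move=> z sz; rewrite ltnS (big_rem z) //= leq_maxl.
exists c, (size s); split; first by rewrite Hc.
  by rewrite Hc //= (last_nth 0).
move=> j js; rewrite !Hc //= ?ltnS ?(ltnW js) //.
by move/(pathP 0): Es => /(_ j js).
Qed.

Lemma path_connected_vertex V E x y : graph V E ->
  path_connected E x y -> x != y -> x \in V.
Proof.
move=> [EV _ _] [[|z s] /= + <-]; first by rewrite eqxx.
by move=> /andP[/EV[]].
Qed.

(* Vertices are shifted by one; the new element 0 is a loop, which keeps the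
   enumeration of dependent sets total when no two vertices are connected. *)
Definition graph_ground (V : pred nat) : pred nat :=
  fun i => (i == 0) || V i.-1.

Definition valid_path (E : rel nat) (b c l : nat) : bool :=
  all (fun j => E (digit b c j) (digit b c j.+1)) (iota 0 l)
  && (digit b c 0 != digit b c l).

(** An index packs a finite set, cut down to the ground set, with a candidate path. A valid path is
    a certificate of dependence checkable by bounded search; an invalid one falls back on the loop
    0. *)
Definition connected_fset (V : pred nat) (E : rel nat) (k : nat) : {fset nat} :=
  let a := unpair1 k in
  let b := unpair1 (unpair2 k) in
  let c := unpair1 (unpair2 (unpair2 k)) in
  let l := unpair2 (unpair2 (unpair2 k)) in
  bounded_fset (a + (digit b c 0).+2 + (digit b c l).+2)
    (fun x => (bit a x && graph_ground V x)
      || (valid_path E b c l && ((x == (digit b c 0).+1) || (x == (digit b c l).+1)))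
      || (~~ valid_path E b c l && (x == 0))).

Lemma in_connected_fset V E a b c l x :
  (x \in connected_fset V E
     (pair_code a (pair_code b (pair_code c l)))) =
  (bit a x && graph_ground V x)
      || (valid_path E b c l && ((x == (digit b c 0).+1) || (x == (digit b c l).+1)))
      || (~~ valid_path E b c l && (x == 0)).
Proof.
rewrite /connected_fset !(pair_code1K, pair_code2K) in_bounded_fset.
apply: andb_idl => /orP[/orP[/andP[/bit_lt + _]|/andP[_ /orP[]/eqP]]|/andP[_ /eqP]];
  lia.
Qed.

Definition has_connected_pair (E : rel nat) (Y : {fset nat}) : Prop :=
  exists x y, [/\ x.+1 \in Y, y.+1 \in Y, x != y & path_connected E x y].

Lemma in_range_connected V E (Y : {fset nat}) : graph V E ->
  in_range (connected_fset V E) Y <->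
  {subset Y <= graph_ground V} /\ (0 \in Y \/ has_connected_pair E Y).
Proof.
move=> G; split=> [[k <-]|[YM HY]].
  rewrite /connected_fset.
  set a := unpair1 k; set b := unpair1 _; set c := unpair1 _; set l := unpair2 _.
  split=> [x|].
    rewrite in_bounded_fset => /andP[_].
    move=> /orP[/orP[/andP[_ //]|/andP[v xE]]|/andP[_ /eqP->] //].
    have [EV symE _] := G.
    move: v => /andP[/allP v dn].
    have conn : path_connected E (digit b c 0) (digit b c l).
      by apply: path_connected_iter => j jl; apply: v; rewrite mem_iota.
    have V0 := path_connected_vertex G conn dn.
    have Vl : digit b c l \in V.
      apply: path_connected_vertex G (path_connected_sym symE conn) _.
      by rewrite eq_sym.
    by case/orP: xE => /eqP->.
  case v: (valid_path E b c l); last first.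
    by left; rewrite in_bounded_fset /= orbT andbT; lia.
  right; exists (digit b c 0), (digit b c l).
  move: v => /andP[/allP v dn]; split=> //.
  - by rewrite in_bounded_fset eqxx /= orbT /= andbT; lia.
  - by rewrite in_bounded_fset eqxx /= !orbT /= andbT; lia.
  by apply: path_connected_iter => j jl; apply: v; rewrite mem_iota.
have [Y0|[x [y [xY yY xy /path_connected_digits[b [c [l [d0 dl Hd]]]]]]]] := HY.
  (* A path of length 0 has equal endpoints and is invalid, so the index adds only the loop, which
     [Y] already contains. *)
  exists (pair_code (fset_code Y) (pair_code 0 (pair_code 0 0))).
  apply/fsetP => x; rewrite in_connected_fset bit_fset_code.
  rewrite /valid_path eqxx andbF /= orbF; case Yx: (x \in Y) => /=.
    by rewrite (YM _ Yx : graph_ground V x).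
  by apply/eqP => x0; rewrite x0 Y0 in Yx.
exists (pair_code (fset_code Y) (pair_code b (pair_code c l))).
apply/fsetP => z; rewrite in_connected_fset bit_fset_code.
have -> : valid_path E b c l.
  rewrite /valid_path d0 dl xy andbT; apply/allP => j.
  by rewrite mem_iota => /Hd.
rewrite /= orbF d0 dl; case Yz: (z \in Y) => /=; first by rewrite (YM _ Yz : graph_ground V z).
by apply/orP => -[]/eqP E'; rewrite E' ?xY ?yY in Yz.
Qed.

(** For exchange, suppose that no element of [Y] can be added to [X]. Each then lies in the
    component of some element of [X], and distinct elements of the independent set [Y] cannot share
    one, so [Y] is no larger than [X]. *)
Lemma connected_fset_ematroid V E : graph V E ->
  ematroid (graph_ground V) (connected_fset V E).
Proof.
move=> G; have range Y := in_range_connected Y G; have [EV symE _] := G.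
split=> [k|k|Y YM [k kY]|X Y XM YM XY rX rY].
- by have [] := (range (connected_fset V E k)).1 (ex_intro _ k erefl).
- have [_ H] := (range (connected_fset V E k)).1 (ex_intro _ k erefl).
  by apply/fset0Pn; case: H => [H|[x [y [H _ _ _]]]]; [exists 0 | exists x.+1].
- apply/range; split=> //.
  have [_ H] := (range (connected_fset V E k)).1 (ex_intro _ k erefl).
  case: H => [H|[x [y [H H' xy c]]]]; [left|right; exists x, y; split=> //];
    exact: (fsubsetP kY).
apply: NNPP => noy.
have Y0 : 0 \notin Y by apply/negP => Y0; apply: rY; apply/range; split; [|left].
have X0 : 0 \notin X by apply/negP => X0; apply: rX; apply/range; split; [|left].
suff : #|` Y| <= #|` X| by rewrite leqNgt XY.
apply: (@leq_card_fset_rel _ _ (fun y x => path_connected E y.-1 x.-1)).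
  move=> y Yy.
  have : in_range (connected_fset V E) (y |` X).
    by apply: NNPP => H; apply: noy; exists y.
  move=> /range[_ [|[u [w]]]].
    by rewrite !inE (negbTE X0) orbF => /eqP y0; rewrite y0 Yy in Y0.
  rewrite !inE => -[/orP[/eqP uy|uX] /orP[/eqP wy|wX] uw c].
  - by move: uw; rewrite -eqSS uy wy eqxx.
  - by exists w.+1 => //; rewrite -uy.
  - by exists u.+1 => //; rewrite -wy; apply: path_connected_sym.
  - by case: rX; apply/range; split=> //; right; exists u, w.
move=> [|y] [|y'] Yy Yy' x /= c c'; rewrite ?Yy ?Yy' // in Y0 *.
apply/eqP/negPn/negP => yy'; apply: rY; apply/range; split=> //.
right; exists y, y'; split=> //; apply: path_connected_trans c _.
exact: path_connected_sym.
Qed.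

(** Halving a code drops its lowest bit and moves every other element down by one, which undoes the
    shift of the vertices. *)
Lemma half_fset_code (B : {fset nat}) : 0 \notin B ->
  fset_decode (fset_code B)./2 =i [pred v | v.+1 \in B].
Proof.
move=> B0 v; rewrite in_fset_decode !inE -bit_fset_code /bit.
by rewrite expnS divnMA divn2.
Qed.

Lemma GAC_fin_le_EMB_fin : sW_le GAC_fin EMB_fin.
Proof.
pose V' (p : nat -> nat) v := p v.*2.*2.+1 == 1.
pose E' (p : nat -> nat) x y := p (pair_code x y).*2.+1.*2.+1 == 1.
apply: (sW_le_computable (psi := fun r _ => (r 0)./2) (phi := fun p =>
  triple_name (p 0) (graph_ground (V' p))
    (fun k => fset_code (connected_fset (V' p) (E' p) k)))).
- apply: computable_triple_name; try by rewrite /graph_ground /V'; computability.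
  apply: (eq_computable (fun p xs => esym (fset_code_bounded_fset _ _))).
  rewrite /valid_path /graph_ground /V' /E' /digit.
  by computability.
- by computability.
move=> p [n [V E]] [/= pn [pV pE]] [G Gn].
have VE : V' p =1 V by move=> v; rewrite /V' pV; case: (V v).
have EE x y : E' p x y = E x y by rewrite /E' pE; case: (E x y).
have [EV symE irrE] := G.
have range Y := in_range_connected Y G.
exists (n, (graph_ground V, connected_fset V E)); split.
- split=> //=; split=> i; rewrite ?triple_name1 ?triple_name2.
    by rewrite /graph_ground VE.
  congr fset_code; apply/fsetP => x; rewrite /connected_fset !in_bounded_fset.
  rewrite /graph_ground VE /valid_path.
  by under eq_all => j do rewrite EE.
- split; first exact: connected_fset_ematroid.
  move=> Y YM Yn; apply/range; split=> //.
  (* A set with the loop is dependent; without it, [predn] is injective on [Y] and yields [n]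
     genuine vertices. *)
  case Y0: (0 \in Y); [by left | right].
  have [||x [y [xY yY xy c]]] := Gn [fset v.-1 | v in Y].
  + move=> v /imfsetP[[|w] /= Yw ->]; first by rewrite Yw in Y0.
    by have := YM _ Yw.
  + rewrite card_in_imfset // => -[|v] [|w] /=; rewrite ?Y0 // => _ _ /= -> //.
  exists x, y; split=> //.
    by case/imfsetP: xY => -[|w] /= Yw ->; rewrite ?Yw // Yw in Y0.
  by case/imfsetP: yY => -[|w] /= Yw ->; rewrite ?Yw // Yw in Y0.
move=> r B /= rB [BM Be Bb].
have noB : ~ in_range (connected_fset V E) B by move=> [k kB]; apply: (Be k); rewrite kB.
have B0 : 0 \notin B.
  by apply/negP => B0; apply: noB; apply/range; split; [|left].
have AE := half_fset_code B0.
exists (fset_decode (fset_code B)./2); split; first by rewrite /= fset_decodeK rB.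
have antiB : antichain V E (mem (fset_decode (fset_code B)./2)).
  split=> [v|x y].
    by rewrite AE => /BM.
  rewrite !AE => Bx By xy c; apply: noB; apply/range; split=> //.
  by right; exists x, y.
split=> // A' [A'V A'c] AA' v; apply/idP/idP => [A'v|/AA' //].
apply/negPn/negP; rewrite AE inE => Bv.
(* The dependent set provided by the basis property lies in [B] together with [v.+1], so its
   connected pair consists of members of the antichain [A']. *)
have [] := Bb v.+1 _ Bv; first exact: A'V.
move=> k kB; have [_ H] := (range (connected_fset V E k)).1 (ex_intro _ k erefl).
have A'w w : w.+1 \in connected_fset V E k -> w \in A'.
  move=> /kB; rewrite !inE => /orP[/eqP[->] //|Bw].
  by apply: AA'; rewrite AE.
case: H => [/kB|[x [y [/A'w xk /A'w yk xy c]]]].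
  by rewrite !inE /= (negbTE B0).
exact: (A'c x y).
Qed.

(** * Missing sets of maximal size as antichains *)

Definition level (v : nat) : nat := unpair1 v.
Definition witness (v : nat) : nat := unpair1 (unpair2 v).
Definition stage (v : nat) : nat := unpair2 (unpair2 v).
Definition vertex_code (i a t : nat) : nat := pair_code i (pair_code a t).

Lemma level_code i a t : level (vertex_code i a t) = i.
Proof. exact: pair_code1K. Qed.

Lemma witness_code i a t : witness (vertex_code i a t) = a.
Proof. by rewrite /witness pair_code2K pair_code1K. Qed.

Lemma stage_code i a t : stage (vertex_code i a t) = t.
Proof. by rewrite /stage !pair_code2K. Qed.

Definition vertexE := (level_code, witness_code, stage_code).

(** Bottom vertices carry the witness 0, the code of the empty set, which is the right answer when
    the maximal missing size is 0. *)
Definition witness_vertex (fc : nat -> nat) (v : nat) : bool :=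
  ((level v == 0) && (witness v == 0)) ||
  [&& 0 < level v, level v <= card_code (witness v) &
    all (fun a => ~~ (level v <= card_code a)
                  || has (fun u => fc u == a) (iota 0 (stage v)))
      (iota 0 (witness v))].

(** The stage of a bottom vertex serves as an index of the enumeration: that vertex is joined to all
    vertices whose witness is enumerated there. Adjacency thus stays decidable although being
    enumerated is not. *)
Definition witness_adj (fc : nat -> nat) (v w : nat) : bool :=
  [|| (level v == level w) && (witness v == witness w),
      (level v == 0) && (fc (stage v) == witness w)
    | (level w == 0) && (fc (stage w) == witness v)].

Definition witness_edge (fc : nat -> nat) (v w : nat) : bool :=
  [&& witness_vertex fc v, witness_vertex fc w, ~~ (v == w) & witness_adj fc v w].

Definition max_witness (A : nat) : nat :=
  \max_(0 <= v < A) (bit A v && (level v == (card_code A).-1)) * witness v.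

Lemma witness_graph fc : graph (witness_vertex fc) (witness_edge fc).
Proof.
split=> [v w /and4P[]//|v w|v]; last by rewrite /witness_edge eqxx !andbF.
rewrite /witness_edge andbCA; congr [&& _, _, _ & _]; first by rewrite eq_sym.
rewrite /witness_adj (eq_sym (level v)) (eq_sym (witness v) (witness w)).
by congr (_ || _); rewrite orbC.
Qed.

Lemma card_bounded_fsetT k : #|` bounded_fset k xpredT| = k.
Proof.
have /perm_size -> : perm_eq (bounded_fset k xpredT) (iota 0 k).
  apply: uniq_perm => [||x]; rewrite ?fset_uniq ?iota_uniq //.
  by rewrite in_bounded_fset andbT mem_iota.
by rewrite size_iota.
Qed.

(** * Components of the witness graph *)

Section WitnessGraph.

Variables (fc : nat -> nat) (m : nat).

Let hit a := exists u, fc u = a.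

Hypothesis fc_gt0 : forall u, fc u != 0.
Hypothesis m_missing : exists2 a, m <= card_code a & ~ hit a.
Hypothesis m_max : forall a, m < card_code a -> hit a.

Let V := witness_vertex fc.
Let E := witness_edge fc.

Definition first_missing i a :=
  [/\ i <= card_code a, ~ hit a & forall a', a' < a -> i <= card_code a' -> hit a'].

Lemma first_missing_uniq i a a' :
  first_missing i a -> first_missing i a' -> a = a'.
Proof.
move=> [ia Ha La] [ia' Ha' La']; case: (ltngtP a a') => // lt.
  by case: Ha; apply: La' lt ia.
by case: Ha'; apply: La lt ia'.
Qed.

Lemma first_missing_exists i a :
  i <= card_code a -> ~ hit a -> exists a', first_missing i a'.
Proof.
elim/ltn_ind: a => a IH ia Ha.
case: (classic (exists a', [/\ a' < a, i <= card_code a' & ~ hit a'])).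
  by move=> [a' [lt ia' Ha']]; apply: IH lt ia' Ha'.
move=> H; exists a; split=> // a' lt ia'; apply: NNPP => Ha'.
by apply: H; exists a'.
Qed.

(** There are finitely many smaller candidates, so a single stage lies beyond an index for each of
    them. *)
Lemma first_missing_vertex i a : 0 < i -> first_missing i a ->
  exists t, V (vertex_code i a t).
Proof.
move=> i0 [ia Ha La].
suff [t Ht] : exists t, forall a', a' < a -> i <= card_code a' ->
    has (fun u => fc u == a') (iota 0 t).
  exists t; rewrite /V /witness_vertex !vertexE i0 ia /=; apply/orP; right.
  apply/allP => a'; rewrite mem_iota /= => /Ht H.
  by rewrite -implybE; apply/implyP.
elim: a {ia Ha} La => [|a IH] La; first by exists 0.
have [|t Ht] := IH; first by move=> a' lt; apply: La; apply: ltnW.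
have [ia|ia] := boolP (i <= card_code a); last first.
  exists t => a'; rewrite ltnS leq_eqVlt => /orP[/eqP->|]; last exact: Ht.
  by move=> H; rewrite H in ia.
have [u Hu] := La a (ltnSn a) ia; exists (t + u.+1) => a'.
rewrite ltnS leq_eqVlt => /orP[/eqP-> _|lt ia'].
  by apply/hasP; exists u; [rewrite mem_iota; lia | rewrite Hu].
by rewrite iotaD has_cat Ht.
Qed.

(** The label [c] of the component of [v], 0 for the bottom. It is a relation because no decision
    procedure tells whether a witness is ever enumerated. *)
Definition witness_class v c :=
  [/\ 0 < level v, ~ hit (witness v) & c = level v] \/
  (level v = 0 \/ hit (witness v)) /\ c = 0.

Lemma witness_class_exists v : exists c, witness_class v c.
Proof.
case: (classic (level v = 0 \/ hit (witness v))) => H; first by exists 0; right.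
exists (level v); left; split=> //; first by rewrite lt0n; apply/eqP; tauto.
by tauto.
Qed.

Lemma witness_class_uniq v c c' : witness_class v c -> witness_class v c' -> c = c'.
Proof.
case=> [[l0 H ->]|[H ->]] [[l0' H' ->]|[H' ->]] //.
  by case: H' => [l|//]; rewrite l in l0.
by case: H => [l|//]; rewrite l in l0'.
Qed.

Lemma witness_vertex_missing v : V v -> 0 < level v -> ~ hit (witness v) ->
  first_missing (level v) (witness v).
Proof.
move=> /orP[/andP[/eqP->]//|/and3P[_ lv /allP Hv]] _ Hw; split=> // a lt la.
have /Hv : a \in iota 0 (witness v) by rewrite mem_iota.
by rewrite la /= => /hasP[u _ /eqP]; exists u.
Qed.

Lemma witness_class_le v c : V v -> witness_class v c -> c <= m.
Proof.
move=> Vv [[l0 H ->]|[_ -> //]].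
have [lw _ _] := witness_vertex_missing Vv l0 H.
by rewrite leqNgt; apply/negP => ml; apply: H; apply: m_max; apply: leq_trans lw.
Qed.

Lemma witness_adj_connected v w :
  V v -> V w -> witness_adj fc v w -> path_connected E v w.
Proof.
move=> Vv Vw adj; have [->|vw] := eqVneq v w; first exact: path_connected_refl.
by apply: path_connected1; rewrite /E /witness_edge -/(V v) Vv -/(V w) Vw vw.
Qed.

Lemma bottom_vertex t : V (vertex_code 0 0 t).
Proof. by rewrite /V /witness_vertex !vertexE. Qed.

Lemma connected_to_bottom v :
  V v -> witness_class v 0 -> path_connected E v (vertex_code 0 0 0).
Proof.
move=> Vv [[l0 _ l]|[[l0|[u Hu]] _]]; first by rewrite -l in l0.
  apply: witness_adj_connected (bottom_vertex 0) _ => //.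
  move: Vv; rewrite /V /witness_vertex /witness_adj !vertexE l0 /= orbF.
  by move=> /eqP->.
(* The bottom vertex at stage [u] is adjacent to [v], since [u] enumerates the witness of [v], and
   to every other bottom vertex. *)
apply: (@path_connected_trans _ _ (vertex_code 0 0 u)).
  apply: witness_adj_connected (bottom_vertex u) _ => //.
  by rewrite /witness_adj !vertexE Hu !eqxx /= !orbT.
apply: witness_adj_connected; try exact: bottom_vertex.
by rewrite /witness_adj !vertexE.
Qed.

(** In class 0 both vertices reach the bottom. In a positive class both witnesses are the least
    missing code for the same level, so the vertices differ at most in their stage. *)
Lemma witness_class_connected v w c : V v -> V w ->
  witness_class v c -> witness_class w c -> path_connected E v w.
Proof.
have [_ symE _] := witness_graph fc.
move=> Vv Vw; have [->|c0] := posnP c => cv cw.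
  apply: path_connected_trans (connected_to_bottom Vv cv) _.
  exact: path_connected_sym symE (connected_to_bottom Vw cw).
case: cv => [[lv Hv cv]|[_ c0']]; last by rewrite c0' in c0.
case: cw => [[lw Hw cw]|[_ c0']]; last by rewrite c0' in c0.
apply: witness_adj_connected => //; rewrite /witness_adj -cv -cw eqxx.
have := witness_vertex_missing Vw lw Hw; rewrite -cw cv => Mw.
by rewrite (first_missing_uniq (witness_vertex_missing Vv lv Hv) Mw) eqxx.
Qed.

(** An edge either preserves level and witness or joins a bottom vertex to one with an enumerated
    witness, both of class 0. *)
Lemma witness_class_edge v w c : E v w -> witness_class v c -> witness_class w c.
Proof.
move=> /and4P[_ _ _ /or3P[]/andP[/eqP H1 /eqP H2]].
- by rewrite /witness_class H1 H2.
- have Hw : hit (witness w) by exists (stage v).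
  by move=> [[+ _ _]|[_ ->]]; [rewrite H1 | right; split=> //; right].
have Hv : hit (witness v) by exists (stage w).
by move=> [[_ []]//|[_ ->]]; right; split=> //; left.
Qed.

Lemma witness_class_path v w c :
  path_connected E v w -> witness_class v c -> witness_class w c.
Proof.
move=> [s Es <-]; elim: s v Es => [|x s IH] v //= /andP[Evx Es] cv.
exact: IH Es (witness_class_edge Evx cv).
Qed.

Lemma witness_class_vertex c : c <= m -> exists2 v, V v & witness_class v c.
Proof.
have [->|c0] := posnP c => cm.
  exists (vertex_code 0 0 0); first exact: bottom_vertex.
  by right; rewrite vertexE; split; [left|].
have [a ma Ha] := m_missing.
(* The missing set of size at least [m] is a candidate for every level up to [m]. *)
have [a' Fa'] := first_missing_exists (leq_trans cm ma) Ha.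
have [t Vt] := first_missing_vertex c0 Fa'; have [_ Ha' _] := Fa'.
by exists (vertex_code c a' t) => //; left; rewrite !vertexE.
Qed.

(** Only the [m.+1] labels from 0 to [m] are available, so two vertices share one. *)
Lemma witness_graph_rank (Y : {fset nat}) : {subset Y <= V} -> m.+1 < #|` Y| ->
  exists x y, [/\ x \in Y, y \in Y, x != y & path_connected E x y].
Proof.
move=> YV; rewrite ltnNge => /negP H; apply: NNPP => noc; apply: H.
rewrite -[X in _ <= X]card_bounded_fsetT; apply: (leq_card_fset_rel (R := witness_class)).
  move=> y Yy; have [c Hc] := witness_class_exists y; exists c => //.
  by rewrite in_bounded_fset andbT ltnS; apply: witness_class_le (YV _ Yy) Hc.
move=> x y Yx Yy c cx cy; apply/eqP/negPn/negP => xy; apply: noc.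
exists x, y; split=> //; apply: witness_class_connected cx cy; exact: YV.
Qed.

(** * Reading a missing set off a maximal antichain *)

Section MaximalAntichain.

Variable A : {fset nat}.
Hypothesis maxA : maximal_antichain V E (mem A).

(** A vertex of a class that [A] misses could be added to [A], since paths preserve classes. *)
Lemma maximal_antichain_class c : c <= m -> exists2 v, v \in A & witness_class v c.
Proof.
have [[AV Ac] Amax] := maxA; have [_ symE _] := witness_graph fc.
move=> /witness_class_vertex[v0 Vv0 cv0]; apply: NNPP => noA.
have notA x : x \in A -> ~ path_connected E v0 x.
  by move=> Ax conn; apply: noA; exists x => //; apply: witness_class_path conn cv0.
have /Amax H : antichain V E (predU1 v0 (mem A)).
  split=> [v|x y]; first by rewrite !inE => /orP[/eqP->|/AV].
  rewrite !inE => /orP[/eqP->|Ax] /orP[/eqP->|Ay]; rewrite ?eqxx //.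
  - by move=> _; apply: notA.
  - by move=> _ /(path_connected_sym symE); apply: notA.
  - exact: Ac.
apply: noA; exists v0 => //; rewrite -[_ \in _]H ?inE ?eqxx //.
by move=> v Av; rewrite inE /= Av orbT.
Qed.

Lemma card_maximal_antichain : #|` A| = m.+1.
Proof.
have [[AV Ac] _] := maxA.
apply/eqP; rewrite eqn_leq leqNgt; apply/andP; split.
  apply/negP => /(witness_graph_rank AV)[x [y [Ax Ay xy]]]; exact: Ac.
rewrite -[X in X <= _]card_bounded_fsetT.
apply: (leq_card_fset_rel (R := fun c v => witness_class v c)).
  by move=> c; rewrite in_bounded_fset andbT ltnS => /maximal_antichain_class.
by move=> c c' _ _ v; apply: witness_class_uniq.
Qed.

Lemma max_witness_missing :
  m <= card_code (max_witness (fset_code A)) /\ ~ hit (max_witness (fset_code A)).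
Proof.
have [[AV _] _] := maxA.
rewrite /max_witness (card_codeE (fset_code A)) fset_codeK card_maximal_antichain /=.
under eq_bigr do rewrite bit_fset_code.
have [m0|m0] := posnP m.
  (* For [m = 0] only bottom vertices count, and the maximum 0 codes the empty set, which [fc_gt0]
     keeps out of the enumeration. *)
  rewrite m0 big1 => [|v _].
    by split=> // -[u Hu]; have := fc_gt0 u; rewrite Hu.
  case Av: (v \in A) => //=; case: eqP => // lv.
  by have : V v := AV _ Av; rewrite /V /witness_vertex lv /= orbF => /eqP->.
have [v Av [[lv Hv mv]|[_ m0']]] := maximal_antichain_class (leqnn m); last first.
  by rewrite m0' in m0.
have [mw _ Lw] := witness_vertex_missing (AV _ Av) lv Hv.
suff -> : \max_(0 <= w < fset_code A) ((w \in A) && (level w == m)) * witness w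
  = witness v by rewrite mv.
rewrite big_mkord; apply/eqP; rewrite eqn_leq; apply/andP; split; last first.
  apply: leq_trans (leq_bigmax (Ordinal (ltn_fset_code Av))).
  by rewrite /= Av -mv eqxx mul1n.
apply/bigmax_leqP => w _; case Aw: (nat_of_ord w \in A) => //=.
(* A larger witness at level [m] would have the witness of [v] among the candidates it certifies as
   enumerated. *)
case: eqP => // lw; rewrite mul1n leqNgt; apply/negP => lt.
have : V w := AV _ Aw; rewrite /V /witness_vertex lw.
case/orP=> [/andP[/eqP m0']|/and3P[_ _ /allP/(_ (witness v))]].
  by rewrite m0' in m0.
rewrite mem_iota mv mw => /(_ lt) /= /hasP[u _ /eqP Hu].
by apply: Hv; exists u.
Qed.

End MaximalAntichain.
End WitnessGraph.

(** Lower [n] until a missing set of that size or more appears; the empty set, of code 0, is always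
    missing, so the descent stops before all sets are enumerated. *)
Lemma max_missing_exists (fc : nat -> nat) n : (forall u, fc u != 0) ->
  (forall a, n <= card_code a -> exists u, fc u = a) ->
  exists2 m, m < n & (exists2 a, m <= card_code a & ~ exists u, fc u = a) /\
    forall a, m < card_code a -> exists u, fc u = a.
Proof.
move=> fc0; elim: n => [|n IH] Hn.
  by have [//|u Hu] := Hn 0; have := fc0 u; rewrite Hu.
case: (classic (exists2 a, n <= card_code a & ~ exists u, fc u = a)) => H.
  by exists n.
have [|m mn Hm] := IH; last by exists m => //; apply: ltnW.
by move=> a na; apply: NNPP => Ha; apply: H; exists a.
Qed.

Lemma Cmax_card_le_GAC_fin : sW_le Cmax_card GAC_fin.
Proof.
pose fc (p : nat -> nat) u := p u.*2.+1.
apply: (sW_le_computable (psi := fun r _ => max_witness (r 0)) (phi := fun p =>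
  triple_name (p 0).+1 (witness_vertex (fc p))
    (fun z => witness_edge (fc p) (unpair1 z) (unpair2 z)))).
- apply: computable_triple_name;
    rewrite /witness_edge /witness_adj /witness_vertex /level /witness /stage /fc;
    by computability.
- by rewrite /max_witness /level /witness; computability.
move=> p [n f] [/= pn pf] [f0 fn].
have fcE u : fc p u = fset_code (f u) by rewrite /fc pf.
have fc0 u : fc p u != 0 by rewrite fcE fset_code_eq0.
have hitE Y : (exists u, fc p u = fset_code Y) <-> in_range f Y.
  by split=> -[u Hu]; exists u; [apply: fset_code_inj|]; rewrite -?fcE // fcE Hu.
have [|m mn [mM Mm]] := @max_missing_exists (fc p) n fc0.
  move=> a; rewrite card_codeE => /fn /hitE [u Hu].
  by exists u; rewrite Hu fset_decodeK.
(* There are [m.+1] components and [m < n], so [n.+1] vertices always contain a connected pair. *)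
exists (n.+1, (witness_vertex (fc p), witness_edge (fc p))); split.
- split=> /=; first by rewrite /triple_name /= pn.
  split=> [v|x y]; first by rewrite triple_name1.
  by rewrite triple_name2 pair_code1K pair_code2K.
- split; first exact: witness_graph.
  move=> Y YV Yn; apply: (witness_graph_rank (m := m)) => //.
  by rewrite Yn ltnS.
move=> r A /= rA maxA.
have [mw hw] := max_witness_missing fc0 mM Mm maxA.
exists (fset_decode (max_witness (fset_code A))); split.
  by rewrite /= fset_decodeK rA.
split=> [/hitE|Y]; first by rewrite fset_decodeK.
rewrite -card_codeE => wY; apply/hitE; apply: Mm.
by rewrite card_codeE fset_codeK; apply: leq_ltn_trans wY.
Qed.

Theorem theorem3p9 :
  [/\ sW_equiv EMB_fin GAC_fin,
      sW_equiv GAC_fin Cmax_subset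
    & sW_equiv Cmax_subset Cmax_card].
Proof.
have SC := Cmax_subset_le_Cmax_card; have CG := Cmax_card_le_GAC_fin.
have GE := GAC_fin_le_EMB_fin; have ES := EMB_fin_le_Cmax_subset.
have SG := sW_le_trans SC CG; have GS := sW_le_trans GE ES.
by split; split=> //; [apply: sW_le_trans ES SG | apply: sW_le_trans CG GS].
Qed.
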